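(* Let $k\in\mathbb{C}$. If $\mathrm{Re}(k)>0$, then the radial symbol $\gamma_k(|w|)=k\,e^{(1-k)|w|^2}$ belongs to $L_1^\infty(\mathbb{R}_+,e^{-r^2})$ and the sequence $\{k^{-n}\}_{n\in\mathbb{N}}$ is obtained from it, i.e. $$k^{-n}=\frac{2}{n!}\int_0^\infty\gamma_k(r)\,r^{2n+1}e^{-r^2}\,dr\qquad\text{for all }n\in\mathbb{N}.$$
   Context: $\mathbb{N}=\{0,1,2,\dots\}$. $L_1^\infty(\mathbb{R}_+,e^{-r^2})$ is the set of measurable functions $\phi$ on $\mathbb{R}_+$ such that $\int_0^\infty|\phi(r)|r^m e^{-r^2}dr<\infty$ for all $m\in\mathbb{N}$. A radial symbol is a function on $\mathbb{C}$ depending only on $|w|$, identified with a function of $r=|w|\in\mathbb{R}_+$. *)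

(* Defs.v *)
From HB Require Import structures.
From mathcomp Require Import all_boot all_order all_algebra.
From mathcomp Require Import all_classical all_reals all_analysis.
From mathcomp Require Import complex.

Set Implicit Arguments.
Unset Strict Implicit.
Unset Printing Implicit Defensive.

Import Order.TTheory GRing.Theory Num.Theory.
Import numFieldNormedType.Exports.

Local Open Scope classical_set_scope.
Local Open Scope ring_scope.
Local Open Scope complex_scope.

(* exp (x + iy) = exp x * (cos y + i sin y) *)
Definition cexp (R : realType) (z : R[i]) : R[i] :=
  (expR (complex.Re z))%:C * (cos (complex.Im z) +i* sin (complex.Im z)).

(* The real-valued modulus; the library's `|z| takes its values in R[i]. *)
Definition cmod (R : realType) (z : R[i]) : R := complex.Re `|z|.

(* Measurability for the Borel sigma-algebra of the plane. *)
Definition cmeasurable (R : realType) (D : set R) (f : R -> R[i]) : Prop :=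
  measurable_fun D (fun x => complex.Re (f x)) /\
  measurable_fun D (fun x => complex.Im (f x)).

(* Lebesgue integral of a complex-valued function. Like Rintegral, it is total
   and meaningful only for integrable f. *)
Definition cintegral (R : realType) (D : set R) (f : R -> R[i]) : R[i] :=
  Rintegral (@lebesgue_measure R) D (fun x => complex.Re (f x)) +i*
  Rintegral (@lebesgue_measure R) D (fun x => complex.Im (f x)).

Definition Rplus (R : realType) : set R := `[0, +oo[%classic.
Arguments Rplus : clear implicits.

Definition gauss (R : realType) (r : R) : R := expR (- r ^+ 2).

Definition L1infty (R : realType) (omega : R -> R) : set (R -> R[i]) :=
  [set phi | cmeasurable (Rplus R) phi /\
    forall m : nat, (\int[@lebesgue_measure R]_(r in Rplus R)
      (cmod (phi r) * r ^+ m * omega r)%:E < +oo)%E].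

Definition radial (R : realType) (a : R[i] -> R[i]) : Prop :=
  forall w w' : R[i], cmod w = cmod w' -> a w = a w'.

(* The function of r = |w| with which a radial symbol is identified; only its
   values on Rplus matter. *)
Definition radial_part (R : realType) (a : R[i] -> R[i]) : R -> R[i] :=
  fun r => a r%:C.

Definition gamma_symbol (R : realType) (k : R[i]) : R[i] -> R[i] :=
  fun w => k * cexp ((1 - k) * (cmod w ^+ 2)%:C).

(* Main.v *)
Require Import Defs.
From HB Require Import structures.
From mathcomp Require Import all_boot all_order all_algebra.
From mathcomp Require Import all_classical all_reals all_analysis.
From mathcomp Require Import measurable_realfun complex ring lra.

Import Order.TTheory GRing.Theory Num.Theory.
Import numFieldNormedType.Exports.

Local Open Scope classical_set_scope.
Local Open Scope ring_scope.
Local Open Scope complex_scope.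

(** The weight [exp (- r ^+ 2)] turns the symbol [k exp ((1 - k) r ^+ 2)] into
[k exp (- k r ^+ 2)], which decays like [exp (- Re k * r ^+ 2)]; this gives
membership in the weighted space. The identity
[d/dr (r ^+ m exp (- k r ^+ 2)) =
 m r ^+ (m - 1) exp (- k r ^+ 2) - 2 k r ^+ (m + 1) exp (- k r ^+ 2)],
integrated over the half-line, relates the moment of order [m + 1] to the one
of order [m - 1] ([gauss_moment_rec]); starting from [m = 0] it yields
[2 k ^+ (n + 1) * M = n`!] for the moment [M] of order [2 n + 1]
([gauss_moment_odd]), which is the claim.

The complex calculus is carried out on the real functions
[r ^+ m * Re (z exp (- k r ^+ 2))] with an arbitrary complex amplitude [z]
([gauss_wave]). All of them are bounded by a multiple of [exp (- r)]
([gauss_wave_le]), and this one bound supplies integrability, the vanishing of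
the boundary terms at infinity and the hypothesis of the fundamental theorem
of calculus on the half-line ([Rintegral_expR_dom_FTC]). *)

(** * Integrals over the half-line dominated by an exponential *)

Lemma continuous_cexpRN {R : realType} (c : R) :
  continuous (fun x : R => c * expR (- x)).
Proof.
move=> x; apply: (@cvgM _ _ _ _ (cst c)); first exact: cvg_cst.
by apply: continuous_comp; [exact: opp_continuous|exact: continuous_expR].
Qed.

Lemma cvg_cexpRN {R : realType} (c : R) : c * expR (- x) @[x --> +oo%R] --> 0.
Proof.
rewrite -[X in _ --> X](mulr0 c).
by apply: (@cvgM _ _ _ _ (cst c)); [exact: cvg_cst|exact: cvgr_expR].
Qed.

(** The model dominating function: the pair gives its integrability together
with the value of its integral, since the derivation of the value by the
fundamental theorem of calculus also proves finiteness. *)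
Lemma integrable_expRN {R : realType} (C : R) : 0 <= C ->
  (@lebesgue_measure R).-integrable (Rplus R) (fun x => (C * expR (- x))%:E) /\
  Rintegral (@lebesgue_measure R) (Rplus R) (fun x => C * expR (- x)) = C.
Proof.
move=> C0.
have dE (x : R) : is_derive x 1 (fun x => - C * expR (- x)) (C * expR (- x)).
  by apply: is_derive_eq; rewrite /GRing.scale /=; ring.
have cE := continuous_cexpRN C.
have FE : (\int[@lebesgue_measure R]_(x in Rplus R) (C * expR (- x))%:E
   = C%:E)%E.
  rewrite /Rplus (@ge0_continuous_FTC2y R _ (fun x => - C * expR (- x)) 0 0) //.
  - by rewrite oppr0 expR0 mulr1 EFinN oppeK add0e.
  - by move=> x _; rewrite mulr_ge0 ?expR_ge0.
  - exact: continuous_subspaceT.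
  - exact: cvg_cexpRN.
  - by apply/cvg_at_right_filter; exact: continuous_cexpRN.
  - by move=> x _; rewrite derive1E; apply: derive_val.
split; last by rewrite /Rintegral FE.
apply/integrableP; split.
  apply/measurable_EFinP/measurable_funTS.
  exact: continuous_measurable_fun.
under eq_integral do rewrite /= ger0_norm ?mulr_ge0 ?expR_ge0 //.
by rewrite FE ltry.
Qed.

Lemma integrable_expR_dom {R : realType} (f : R -> R) (C : R) :
  measurable_fun setT f ->
  (forall x, 0 <= x -> `|f x| <= C * expR (- x)) ->
  (@lebesgue_measure R).-integrable (Rplus R) (EFin \o f).
Proof.
move=> mf fC.
have C0 : 0 <= C.
  by have := le_trans (normr_ge0 _) (fC 0 (lexx _)); rewrite oppr0 expR0 mulr1.
have [gi _] := integrable_expRN C C0.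
apply: (le_integrable _ _ _ gi).
- exact: measurable_itv.
- by apply/measurable_EFinP/measurable_funTS.
- move=> x; rewrite /Rplus /= in_itv /= andbT => x0.
  by rewrite lee_fin (le_trans (fC _ x0))// ler_norm.
Qed.

(** The fundamental theorem of calculus on a half-line for an integrand that may
change sign. Adding the dominating [C * expR (- x)] makes the integrand
nonnegative, where monotone convergence applies; the integral [C] of the added
term is then subtracted. *)
Lemma Rintegral_expR_dom_FTC {R : realType} (f F : R -> R) (C l : R) :
  continuous f ->
  (forall x : R, is_derive x 1 F (f x)) ->
  (forall x, 0 <= x -> `|f x| <= C * expR (- x)) ->
  F x @[x --> +oo%R] --> l ->
  Rintegral (@lebesgue_measure R) (Rplus R) f = l - F 0.
Proof.
move=> cf dF fC Fl.
have C0 : 0 <= C.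
  by have := le_trans (normr_ge0 _) (fC 0 (lexx _)); rewrite oppr0 expR0 mulr1.
have [gi gC] := integrable_expRN C C0.
have fi : (@lebesgue_measure R).-integrable (Rplus R) (EFin \o f).
  by apply: integrable_expR_dom fC; exact: continuous_measurable_fun.
have cE := continuous_cexpRN C.
apply: (addIr C); rewrite -{1}gC -RintegralD //; last exact: measurable_itv.
pose G x := F x - C * expR (- x).
have dG (x : R) : is_derive x 1 G (f x + C * expR (- x)).
  by apply: is_derive_eq; rewrite /GRing.scale /=; ring.
rewrite /Rplus (@Rintegral_ge0_continuous_FTC2y R _ G 0 l) //.
- by rewrite /G oppr0 expR0 mulr1; ring.
- by move=> x x0; have := fC _ x0; rewrite ler_norml => /andP[]; lra.
- by apply: continuous_subspaceT => x; apply: cvgD; [exact: cf|exact: cE].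
- rewrite -[X in _ --> X]subr0; apply: cvgB => //.
  exact: cvg_cexpRN.
- by apply/cvg_at_right_filter; apply/differentiable_continuous/derivable1_diffP.
- by move=> x _; rewrite derive1E; apply: derive_val.
Qed.

(** The power is absorbed by one exponential, [r ^+ m <= m`! * expR r], and
completing the square gives [2 r - a r ^+ 2 <= a^-1] for the exponent. *)
Lemma exprM_gauss_le {R : realType} (a : R) (m : nat) (r : R) : 0 < a -> 0 <= r ->
  r ^+ m * expR (- a * r ^+ 2) <= m`!%:R * expR a^-1 * expR (- r).
Proof.
move=> a0 r0.
have h1 : r ^+ m <= m`!%:R * expR r.
  rewrite -ler_pdivrMl ?ltr0n ?fact_gt0 // mulrC.
  case: m => [|m]; first by rewrite expr0 fact0 divr1 -expR0 ler_expR.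
  by apply: le_trans (expR_ge1Dxn m r0); rewrite lerDr.
apply: (le_trans (ler_wpM2r (expR_ge0 _) h1)).
rewrite -!mulrA -!expRD ler_wpM2l // ler_expR.
have -> : a^-1 - r = r + - a * r ^+ 2 + a^-1 * (a * r - 1) ^+ 2.
  by field; rewrite gt_eqF.
by rewrite lerDl mulr_ge0 ?sqr_ge0 // invr_ge0 ltW.
Qed.

(** * Moments of complex Gaussians *)

(** For complex [k] and [z], the real function
[r ^+ m * Re (z * exp (- k r ^+ 2))]. The free factor [z] keeps everything
real-valued: it gives the real part of a complex integrand, it gives the
imaginary part because [Im w = Re (- i * w)], and it absorbs the factor [k]
that each differentiation produces. *)
Definition gauss_wave {R : realType} (k z : R[i]) (m : nat) (r : R) : R :=
  r ^+ m * complex.Re (z * cexp (- k * (r ^+ 2)%:C)).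

Lemma gauss_waveE {R : realType} (k z : R[i]) (m : nat) (r : R) :
  gauss_wave k z m r =
  r ^+ m * expR (- complex.Re k * r ^+ 2) *
  (complex.Re z * cos (complex.Im k * r ^+ 2) +
   complex.Im z * sin (complex.Im k * r ^+ 2)).
Proof.
case: k z => [a b] [p q]; rewrite /gauss_wave /cexp /=.
rewrite !(mulr0, mul0r, subr0, addr0, add0r, oppr0) !mulNr cosN sinN; ring.
Qed.

Lemma gauss_wave_le {R : realType} (k z : R[i]) (m : nat) :
  0 < complex.Re k -> forall r, 0 <= r ->
  `|gauss_wave k z m r| <=
    (`|complex.Re z| + `|complex.Im z|) * (m`!%:R * expR (complex.Re k)^-1)
    * expR (- r).
Proof.
move=> k0 r r0; rewrite gauss_waveE normrM -mulrA mulrC.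
apply: ler_pM => //.
  rewrite (le_trans (ler_normD _ _)) // !normrM.
  by apply: lerD; rewrite ler_piMr // ler_norml ?cos_le1 ?cos_geN1 ?sin_le1 ?sin_geN1.
by rewrite ger0_norm ?mulr_ge0 ?exprn_ge0 ?expR_ge0 // exprM_gauss_le.
Qed.

Lemma gauss_wave_cvg0 {R : realType} (k z : R[i]) (m : nat) :
  0 < complex.Re k -> gauss_wave k z m r @[r --> +oo%R] --> 0.
Proof.
move=> k0; set D := ((`|complex.Re z| + `|complex.Im z|) *
  (m`!%:R * expR (complex.Re k)^-1)).
have DE : D * expR (- r) @[r --> +oo%R] --> 0.
  exact: cvg_cexpRN.
apply/norm_cvg0P.
apply: (@squeeze_cvgr _ _ _ _ (cst 0) (fun r => D * expR (- r))) => //; last exact: cvg_cst.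
near=> r; rewrite normr_ge0 /= gauss_wave_le //.
Unshelve. all: by end_near. Qed.

(** The family is closed under differentiation. For [m = 0] the junk value
[m.-1 = 0] is harmless, as its coefficient vanishes. *)
Lemma is_derive_gauss_wave {R : realType} (k z : R[i]) (m : nat) (r : R) :
  is_derive r 1 (gauss_wave k z m)
   (m%:R * gauss_wave k z m.-1 r - 2 * gauss_wave k (k * z) m.+1 r).
Proof.
have -> : gauss_wave k z m = fun r => r ^+ m * expR (- complex.Re k * r ^+ 2) *
  (complex.Re z * cos (complex.Im k * r ^+ 2) +
   complex.Im z * sin (complex.Im k * r ^+ 2)).
  by apply/funext => x; rewrite gauss_waveE.
have dq (c : R) : is_derive r 1 (fun x : R => c * x ^+ 2) (2 * c * r).
  by apply: is_derive_eq; rewrite /GRing.scale /=; ring.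
have dexp := @is_derive1_comp R expR _ _ _ _ (is_derive_expR _) (dq (- complex.Re k)).
have dcos := @is_derive1_comp R cos _ _ _ _ (is_derive_cos _) (dq (complex.Im k)).
have dsin := @is_derive1_comp R sin _ _ _ _ (is_derive_sin _) (dq (complex.Im k)).
have dX : is_derive r 1 (fun x : R => x ^+ m) (m%:R * r ^+ m.-1).
  have -> : (fun x : R => x ^+ m) = id ^+ m by rewrite exprfctE.
  by apply: is_derive_eq; rewrite /GRing.scale /= mulr1.
have := is_deriveM (is_deriveM dX dexp)
  (is_deriveD (is_deriveZ (complex.Re z) dcos) (is_deriveZ (complex.Im z) dsin)).
move=> /is_derive_eq; apply.
rewrite !fctE !gauss_waveE /GRing.scale /=.
case: k z {dq dexp dcos dsin dX} => [a b] [p q] /=.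
rewrite (exprS r m).
rewrite -![_ *: _]/(_ * _).
ring.
Qed.

Lemma continuous_gauss_wave {R : realType} (k z : R[i]) (m : nat) :
  continuous (gauss_wave k z m).
Proof.
move=> r; have [+ _] := is_derive_gauss_wave k z m r.
by move=> /derivable1_diffP/differentiable_continuous.
Qed.

Lemma integrable_gauss_wave {R : realType} (k z : R[i]) (m : nat) :
  0 < complex.Re k ->
  (@lebesgue_measure R).-integrable (Rplus R) (EFin \o gauss_wave k z m).
Proof.
move=> k0; apply: integrable_expR_dom (gauss_wave_le k z m k0).
by apply: continuous_measurable_fun; exact: continuous_gauss_wave.
Qed.

Lemma Re_gauss_wave {R : realType} (k z : R[i]) (m : nat) (r : R) :
  complex.Re (z * cexp (- k * (r ^+ 2)%:C) * (r ^+ m)%:C) = gauss_wave k z m r.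
Proof. by rewrite /gauss_wave; case: (z * _) => u v /=; ring. Qed.

(* Rewriting with ring lemmas would otherwise unfold waves into products. *)
#[local] Opaque gauss_wave.

Definition gauss_moment {R : realType} (k z : R[i]) (m : nat) : R :=
  Rintegral (@lebesgue_measure R) (Rplus R) (gauss_wave k z m).

(** The integral of the derivative of [gauss_wave k z m] over the half-line is
minus its value at [0], which is nonzero only for [m = 0]. *)
Lemma gauss_moment_rec {R : realType} (k z : R[i]) (m : nat) :
  0 < complex.Re k ->
  m%:R * gauss_moment k z m.-1 - 2 * gauss_moment k (k * z) m.+1 =
  - ((m == 0)%:R * complex.Re z).
Proof.
move=> k0.
have iZ c w n : (@lebesgue_measure R).-integrable (Rplus R)
    (EFin \o (fun r => c * gauss_wave k w n r)).
  refine (@integrableZl _ _ _ (@lebesgue_measure R) (Rplus R) _ c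
    (EFin \o gauss_wave k w n) (integrable_gauss_wave k w n k0)).
  exact: measurable_itv.
have mD : measurable (Rplus R : set (g_sigma_algebraType (R.-ocitv.-measurable))).
  exact: measurable_itv.
rewrite /gauss_moment -!RintegralZl ?integrable_gauss_wave // -RintegralB ?iZ //.
pose C (w : R[i]) n : R := (`|complex.Re w| + `|complex.Im w|) *
  (n`!%:R * expR (complex.Re k)^-1).
transitivity (0 - gauss_wave k z m 0); last first.
  rewrite sub0r gauss_waveE !expr0n /= !mulr0 expR0 cos0 sin0.
  by rewrite !mulr1 mulr0 addr0.
apply: (@Rintegral_expR_dom_FTC _ _ (gauss_wave k z m)
  (m%:R * C z m.-1 + 2 * C (k * z) m.+1)).
- move=> r; apply: cvgB.
    by apply: (@cvgM _ _ _ _ (cst m%:R)); [exact: cvg_cst|exact: continuous_gauss_wave].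
  by apply: (@cvgM _ _ _ _ (cst 2)); [exact: cvg_cst|exact: continuous_gauss_wave].
- by move=> r; exact: is_derive_gauss_wave.
- move=> r r0; rewrite (le_trans (ler_normB _ _)) // [leRHS]mulrDl.
  rewrite -(mulrA _ (C z _)) -(mulrA _ (C (k * z) _)).
  by apply: lerD; rewrite normrM normr_nat; apply: ler_wpM2l => //;
    exact: gauss_wave_le.
- exact: gauss_wave_cvg0.
Qed.

(** Each step of the recurrence trades two powers of [r] for a factor [k] of the
amplitude, so putting [k ^+ n.+1] there beforehand avoids any division by [k]. *)
Lemma gauss_moment_odd {R : realType} (k z : R[i]) (n : nat) :
  0 < complex.Re k ->
  2 * gauss_moment k (k ^+ n.+1 * z) (2 * n + 1) = n`!%:R * complex.Re z.
Proof.
move=> k0; elim: n => [|n IH].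
  have := gauss_moment_rec k z 0 k0.
  by rewrite mul0r sub0r expr1 fact0 eqxx => /oppr_inj.
have := gauss_moment_rec k (k ^+ n.+1 * z) (2 * n.+1) k0.
have -> : (2 * n.+1).-1 = (2 * n + 1)%N by rewrite mulnS addn1.
rewrite mulrA -exprS (addn1 (2 * n.+1)) mul0r oppr0 => /subr0_eq <-.
by rewrite natrM -mulrA mulrCA IH factS natrM mulrA.
Qed.

(** * Modulus and complex exponential *)

Lemma cmodE {R : realType} (z : R[i]) : (cmod z)%:C = `|z|.
Proof. by rewrite /cmod normc_def. Qed.

Lemma cmodM {R : realType} (z w : R[i]) : cmod (z * w) = cmod z * cmod w.
Proof. by apply: complexI; rewrite rmorphM /= !cmodE normrM. Qed.

Lemma cmod_ge0 {R : realType} (z : R[i]) : 0 <= cmod z.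
Proof. by rewrite /cmod normc_def /= sqrtr_ge0. Qed.

Lemma cmod_cexp {R : realType} (z : R[i]) : cmod (cexp z) = expR (complex.Re z).
Proof.
rewrite /cexp cmodM /cmod !normc_def /= cos2Dsin2 sqrtr1 mulr1.
by rewrite expr0n addr0 sqrtr_sqr ger0_norm ?expR_ge0.
Qed.

Lemma cmod_real2 {R : realType} (r : R) : cmod (r%:C) ^+ 2 = r ^+ 2.
Proof. by rewrite /cmod normc_def /= expr0n addr0 sqrtr_sqr real_normK ?num_real. Qed.

Lemma cexpD_real {R : realType} (z : R[i]) (x : R) :
  cexp (z + x%:C) = cexp z * (expR x)%:C.
Proof.
case: z => a b; rewrite /cexp /= addr0 expRD rmorphM /=; ring.
Qed.

(** * The sequence of moments *)

Theorem propositionV1 (R : realType) (k : R[i]) (hk : 0 < complex.Re k) :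
  [/\ radial (gamma_symbol k),
      L1infty (@gauss R) (radial_part (gamma_symbol k)) &
      forall n : nat,
        k ^- n = 2 / (n`!)%:R *
          cintegral (Rplus R) (fun r : R =>
            radial_part (gamma_symbol k) r * (r ^+ (2 * n + 1) * gauss r)%:C)].
Proof.
have ImE (w : R[i]) : complex.Im w = complex.Re (- 'i%C * w).
  by case: w => u v /=; ring.
split.
- by move=> w w' ww'; rewrite /gamma_symbol ww'.
- split.
    (* The symbol itself is a Gaussian wave, with parameter [k - 1]. *)
    split; apply: measurable_funTS.
      rewrite (_ : (fun _ => _) = gauss_wave (k - 1) k 0).
        by apply: continuous_measurable_fun; exact: continuous_gauss_wave.
      apply/funext => r.
      by rewrite /radial_part /gamma_symbol cmod_real2 -Re_gauss_wave expr0 mulr1 opprB.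
    rewrite (_ : (fun _ => _) = gauss_wave (k - 1) (- 'i%C * k) 0).
      by apply: continuous_measurable_fun; exact: continuous_gauss_wave.
    apply/funext => r.
    by rewrite ImE /radial_part /gamma_symbol cmod_real2 -Re_gauss_wave expr0 mulr1 opprB mulrA.
  move=> m.
  (* With real parameter and amplitude the wave does not oscillate: it is the
     modulus that is to be integrated. *)
  have /integrableP[_] := integrable_gauss_wave (complex.Re k)%:C (cmod k)%:C m hk.
  apply: le_lt_trans; rewrite le_eqVlt; apply/orP; left; apply/eqP.
  apply: eq_integral => r; rewrite inE /Rplus /= in_itv /= andbT => r0.
  rewrite gauss_waveE /= mul0r cos0 sin0 mulr0 addr0 mulr1 ger0_norm; last first.
    by rewrite !mulr_ge0 ?exprn_ge0 ?expR_ge0 ?cmod_ge0.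
  congr EFin; rewrite /radial_part /gamma_symbol cmod_real2 cmodM cmod_cexp /gauss.
  have -> : - complex.Re k * r ^+ 2 =
      complex.Re ((1 - k) * (r ^+ 2)%:C) + - r ^+ 2.
    by case: (k) => a b /=; ring.
  by rewrite expRD; ring.
- move=> n.
  have k0 : k != 0 by apply: contraTneq hk => ->; rewrite ltxx.
  have fE r : radial_part (gamma_symbol k) r * (r ^+ (2 * n + 1) * gauss r)%:C =
      k * cexp (- k * (r ^+ 2)%:C) * (r ^+ (2 * n + 1))%:C.
    rewrite /radial_part /gamma_symbol cmod_real2 /gauss.
    rewrite (_ : - k * _ = (1 - k) * (r ^+ 2)%:C + (- r ^+ 2)%:C).
      by rewrite cexpD_real rmorphM /=; ring.
    by rewrite rmorphN /=; ring.
  have kE : k = k ^+ n.+1 * k ^- n by rewrite exprS mulfK ?expf_neq0.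
  have ikE : - 'i%C * k = k ^+ n.+1 * (- 'i%C * k ^- n).
    by rewrite mulrCA -kE.
  have n0 : n`!%:R != 0 :> R by rewrite pnatr_eq0 -lt0n fact_gt0.
  have half z : gauss_moment k (k ^+ n.+1 * z) (2 * n + 1) =
      n`!%:R / 2 * complex.Re z.
    by rewrite mulrAC -(gauss_moment_odd k) //; field.
  (* Both components of the complex integral are moments, with amplitudes [k]
     and [- i * k]. *)
  rewrite /cintegral.
  under eq_Rintegral do rewrite fE Re_gauss_wave.
  under [X in _ +i* X]eq_Rintegral do rewrite fE ImE mulrA (mulrA _ k) Re_gauss_wave.
  rewrite -!/(gauss_moment _ _ _) {3}kE ikE !half -ImE.
  set w := k ^- n.
  transitivity (2 / n`!%:R * ((n`!%:R / 2)%:C * w)).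
    rewrite mulrA rmorphM fmorphV /= !rmorph_nat.
    have n0C : n`!%:R != 0 :> R[i] by rewrite pnatr_eq0 -lt0n fact_gt0.
    by field.
  congr (_ * _); apply/eqP; rewrite eq_complex /=.
  by case: w => u v /=; rewrite !mul0r subr0 addr0 !eqxx.
Qed.
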